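(* Let $(\Omega,\Sigma,\mu)$ be a measure space with $\mu:\Sigma\to[0,\infty]$ a locally determined positive measure, let $X$ be a Banach space over $\mathbb{K}$ ($\mathbb{R}$ or $\mathbb{C}$), let $F:\Omega\to X$ be locally Pettis integrable, and let $\nu_F:\Sigma^f\to X$ be the vector measure $\nu_F(B)=\mathbb{P}\text{-}\int_BF\,d\mu$, $B\in\Sigma^f$. If $X$ does not contain any subspace isomorphic to $c_0$ and $\nu_F$ is bounded, then $F$ is Pettis integrable.
   Context: $\Omega$ is a nonempty set, $\Sigma$ a $\sigma$-algebra on $\Omega$, $\Sigma^f=\{B\in\Sigma:\mu(B)<\infty\}$, a $\delta$-ring (a ring closed under countable intersections). $\mu$ is semi-finite if every $A\in\Sigma$ with $\mu(A)>0$ contains $B\in\Sigma^f$ with $\mu(B)>0$; $\mu$ is locally determined if it is semi-finite and $\Sigma=\{A\subset\Omega: A\cap B\in\Sigma\ \forall B\in\Sigma^f\}$. A function with values in a Banach space is strongly $\mu$-measurable if it is the pointwise $\mu$-a.e. limit of a sequence of simple ($\Sigma$-measurable, finitely valued) functions whose supports have finite $\mu$-measure. $F:\Omega\to X$ is weakly $\mu$-measurable if $\langle F,x^*\rangle$ is strongly $\mu$-measurable for every $x^*\in X^*$ (the dual of $X$). Functions that agree $\mu$-a.e. with $\Sigma$-measurable ones are integrated in the obvious way. A weakly $\mu$-measurable $F$ is Pettis integrable, $F\in\mathbb{P}(\mu,X)$, if $\langle F,x^*\rangle\in L^1(\mu)$ for all $x^*\in X^*$ and for each $A\in\Sigma$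 there is $x_A\in X$ with $\int_A\langle F,x^*\rangle d\mu=\langle x_A,x^*\rangle$ for all $x^*\in X^*$; $x_A=:\mathbb{P}\text{-}\int_AF\,d\mu$. $F$ is locally Pettis integrable if it is weakly $\mu$-measurable and $\chi_BF\in\mathbb{P}(\mu,X)$ for all $B\in\Sigma^f$; then for $B\in\Sigma^f$, $\mathbb{P}\text{-}\int_BF\,d\mu:=\mathbb{P}\text{-}\int_B\chi_BF\,d\mu$. A vector measure $\nu:\Sigma^f\to X$ is a set function countably additive on disjoint sequences of $\Sigma^f$ whose union lies in $\Sigma^f$; it is bounded if $\sup_{B\in\Sigma^f}\|\nu(B)\|_X<\infty$. *)

(* Defs.v *)
From HB Require Import structures.
From mathcomp Require Import all_boot all_order all_algebra.
From mathcomp Require Import all_classical all_reals all_analysis.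
From mathcomp Require Import complex.

Set Implicit Arguments.
Unset Strict Implicit.
Unset Printing Implicit Defensive.

Import Order.TTheory GRing.Theory Num.Theory.
Import numFieldNormedType.Exports.

Local Open Scope classical_set_scope.
Local Open Scope ring_scope.

(* The scalar field is R or R[i]; the choice is an index, so that one statement
   covers both cases. *)
Inductive scalar_kind := RealScalars | ComplexScalars.

Definition base_field (R : realType) (k : scalar_kind) : numFieldType :=
  match k with RealScalars => R | ComplexScalars => R[i] end.

Definition re (R : realType) (k : scalar_kind) : base_field R k -> R :=
  match k return base_field R k -> R with
  | RealScalars => fun z => z
  | ComplexScalars => fun z => complex.Re z
  end.

Definition im (R : realType) (k : scalar_kind) : base_field R k -> R :=
  match k return base_field R k -> R with
  | RealScalars => fun=> 0
  | ComplexScalars => fun z => complex.Im z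
  end.

(* a + i b; the imaginary part is discarded over the reals *)
Definition of_re_im (R : realType) (k : scalar_kind) : R -> R -> base_field R k :=
  match k return R -> R -> base_field R k with
  | RealScalars => fun a _ => a
  | ComplexScalars => fun a b => Complex a b
  end.

Definition of_real (R : realType) (k : scalar_kind) (a : R) : base_field R k :=
  of_re_im k a 0.

(* In a normed module over R[i] the norm takes its values in the nonnegative
   reals of R[i]; over either scalar field, rnorm is the same number in R. *)
Definition rnorm (R : realType) (k : scalar_kind) (V : normedModType (base_field R k))
  (x : V) : R := re `|x|.

Section scalar_lemmas.
Context (R : realType) (k : scalar_kind).

Lemma of_realK : cancel (@of_real R k) (@re R k).
Proof. by case: k. Qed.

Lemma of_re_imK (z : base_field R k) : of_re_im k (re z) (im z) = z.
Proof. by case: k z => //= -[a b]. Qed.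

Lemma of_real_le (a b : R) :
  ((of_real k a : base_field R k) <= of_real k b) = (a <= b).
Proof. by case: k => //; exact: lecR. Qed.

Lemma of_real0 : of_real k 0 = 0 :> base_field R k.
Proof. by case: k. Qed.

Lemma of_realD (a b : R) :
  of_real k (a + b) = of_real k a + of_real k b :> base_field R k.
Proof. by case: k => //=; exact: (rmorphD (real_complex R)). Qed.

Lemma of_realM (a b : R) :
  of_real k (a * b) = of_real k a * of_real k b :> base_field R k.
Proof. by case: k => //=; exact: (rmorphM (real_complex R)). Qed.

Lemma ge0_of_re (z : base_field R k) : 0 <= z -> of_real k (re z) = z.
Proof. by case: k z => //= -[a b]; rewrite lecE/= => /andP[/eqP ->]. Qed.

Lemma rnormK (V : normedModType (base_field R k)) (x : V) : of_real k (rnorm x) = `|x|.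
Proof. exact: ge0_of_re. Qed.

Lemma rnorm_ge0 (V : normedModType (base_field R k)) (x : V) : 0 <= rnorm x.
Proof. by rewrite -of_real_le rnormK of_real0. Qed.

Lemma rnormD (V : normedModType (base_field R k)) (x y : V) : rnorm (x + y) <= rnorm x + rnorm y.
Proof. by rewrite -of_real_le of_realD !rnormK ler_normD. Qed.

Lemma rnormZ (V : normedModType (base_field R k)) (a : base_field R k) (x : V) :
  rnorm (a *: x) = rnorm a * rnorm x.
Proof. by apply: (can_inj of_realK); rewrite of_realM !rnormK normrZ. Qed.

End scalar_lemmas.

Section c0_space.
Context (R : realType) (k : scalar_kind).
Local Notation K := (base_field R k).

Definition c0_pred : {pred nat -> K} :=
  mem [set u : nat -> K | u @ \oo --> (0 : K)].

Lemma c0_predP (u : nat -> K) : reflect (u @ \oo --> (0 : K)) (u \in c0_pred).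
Proof. by apply: (iffP idP); [move/set_mem | exact: mem_set]. Qed.

Lemma c0_submod_closed : submod_closed c0_pred.
Proof.
split; first by apply/c0_predP; exact: cvg_cst.
move=> a u v /c0_predP u0 /c0_predP v0; apply/c0_predP.
have -> : (0 : K) = a *: (0 : K) + 0 by rewrite scaler0 addr0.
exact: (@cvgD K K _ _ _ _ _ _ _ (@cvgZl_tmp K K _ _ _ _ _ _ u0) v0).
Qed.

HB.instance Definition _ := GRing.isSubmodClosed.Build _ _ c0_pred c0_submod_closed.

Record c0 := C0 { c0_val :> nat -> K ; c0_valP : c0_val \in c0_pred }.

HB.instance Definition _ := [isSub for c0_val].
HB.instance Definition _ := [Choice of c0 by <:].
HB.instance Definition _ := [SubChoice_isSubLmodule of c0 by <:].

Definition c0_rnorm (u : c0) : R := sup [set rnorm (u n) | n in [set: nat]].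

Definition c0_norm (u : c0) : K := of_real k (c0_rnorm u).

Lemma c0_cvg (u : c0) : u @ \oo --> (0 : K).
Proof. exact/c0_predP/c0_valP. Qed.

Lemma c0_has_ubound (u : c0) :
  has_ubound [set rnorm (u n) | n in [set: nat]].
Proof.
have /cvg_seq_bounded/pinfty_ex_gt0[M M0 /= uM] : cvg (u @ \oo).
  by apply/cvg_ex; exists 0; exact: c0_cvg.
exists (re M) => _ [n _ <-].
by rewrite -(of_real_le k) rnormK ge0_of_re ?(ltW M0)//; exact: uM.
Qed.

Lemma c0_rnorm_ub (u : c0) n : rnorm (u n) <= c0_rnorm u.
Proof. by apply: ub_le_sup; [exact: c0_has_ubound | exists n]. Qed.

Lemma c0_rnorm_le (u : c0) (M : R) :
  (forall n, rnorm (u n) <= M) -> c0_rnorm u <= M.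
Proof.
by move=> uM; apply: ge_sup; [exists (rnorm (u 0%N)); exists 0%N | move=> _ [n _ <-]].
Qed.

Lemma c0_ler_normD (u v : c0) : c0_norm (u + v) <= c0_norm u + c0_norm v.
Proof.
rewrite /c0_norm -of_realD of_real_le; apply: c0_rnorm_le => n.
by apply: (le_trans (rnormD _ _)); apply: lerD; exact: c0_rnorm_ub.
Qed.

Lemma c0_normrZ (a : K) (u : c0) : c0_norm (a *: u) = `|a| * c0_norm u.
Proof.
rewrite /c0_norm -(rnormK a) -of_realM; congr of_real.
have [->|a0] := eqVneq a 0.
  rewrite scale0r /rnorm normr0 (_ : re 0 = 0) ?mul0r; last by case: (k).
  apply/eqP; rewrite eq_le; apply/andP; split.
    by apply: c0_rnorm_le => n; rewrite /rnorm normr0; case: (k).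
  by apply: le_trans (c0_rnorm_ub _ 0%N); exact: rnorm_ge0.
have a0' : 0 < rnorm a.
  rewrite lt_neqAle rnorm_ge0 andbT eq_sym.
  by apply: contra a0 => /eqP/(congr1 (of_real k)); rewrite rnormK of_real0 => /normr0_eq0/eqP.
apply/eqP; rewrite eq_le; apply/andP; split.
  apply: c0_rnorm_le => n; rewrite (rnormZ a (u n)).
  by rewrite ler_pM2l// c0_rnorm_ub.
rewrite -ler_pdivlMl//; apply: c0_rnorm_le => n.
by rewrite ler_pdivlMl// -(rnormZ a (u n)); exact: (c0_rnorm_ub (a *: u)).
Qed.

Lemma c0_normr0_eq0 (u : c0) : c0_norm u = 0 -> u = 0.
Proof.
move=> /(congr1 (@re R k)); rewrite of_realK -(of_real0 R k) of_realK => u0.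
apply/val_inj/funext => n; apply/normr0_eq0; rewrite -(rnormK (u n)).
rewrite -[RHS](of_real0 R k); congr of_real; apply/eqP.
by rewrite eq_le rnorm_ge0 andbT -u0 c0_rnorm_ub.
Qed.

HB.instance Definition _ := Lmodule_isNormed.Build K c0
  c0_ler_normD c0_normrZ c0_normr0_eq0.

Lemma rnorm_c0 (u : c0) : rnorm u = c0_rnorm u.
Proof. exact: of_realK. Qed.

End c0_space.

(* Y is isomorphic (linearly homeomorphic) to a subspace of X, namely range J *)
Definition contains_copy (K : numFieldType) (X Y : normedModType K) : Prop :=
  exists (J : {linear Y -> X}) (g : X -> Y),
    [/\ continuous J, cancel J g & {within range J, continuous g}].

Section measure_space.
Context (R : realType) (d : measure_display) (T : measurableType d).
Variable mu : {measure set T -> \bar R}.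

Definition finite_measurable : set (set T) :=
  [set B | measurable B /\ (mu B < +oo)%E].

Definition semi_finite : Prop := forall A, measurable A -> (0 < mu A)%E ->
  exists B, [/\ finite_measurable B, B `<=` A & (0 < mu B)%E].

Definition locally_determined : Prop := semi_finite /\
  forall A : set T,
    measurable A <-> (forall B, finite_measurable B -> measurable (A `&` B)).

Section strong_measurability.
Context (K : numFieldType) (V : normedModType K).

Definition finite_support_simple (s : T -> V) : Prop :=
  [/\ finite_set (range s), (forall v, measurable (s @^-1` [set v])) &
      (mu [set x | s x != 0%R] < +oo)%E].

Definition strongly_measurable (f : T -> V) : Prop :=
  exists s : nat -> T -> V, (forall n, finite_support_simple (s n)) /\
    {ae mu, forall x, s n x @[n --> \oo] --> f x}.

End strong_measurability.

Section Pettis.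
Context (k : scalar_kind) (X : normedModType (base_field R k)).
Local Notation K := (base_field R k).

(* g is a measurable integrable representative of f, which need not itself be
   measurable since mu is not assumed complete *)
Definition integrable_version (f g : T -> K) : Prop :=
  [/\ mu.-integrable setT (fun x => (re (g x))%:E),
      mu.-integrable setT (fun x => (im (g x))%:E) &
      {ae mu, forall x, f x = g x}].

Definition in_L1 (f : T -> K) : Prop := exists g, integrable_version f g.

Definition integral_is (A : set T) (f : T -> K) (z : K) : Prop :=
  exists2 g, integrable_version f g &
    z = of_re_im k (\int[mu]_(x in A) re (g x)) (\int[mu]_(x in A) im (g x)).

Definition weakly_measurable (F : T -> X) : Prop :=
  forall phi : {linear X -> K^o}, continuous phi ->
    strongly_measurable (fun w => phi (F w) : K^o).

Definition is_Pettis_integral (A : set T) (F : T -> X) (x : X) : Prop :=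
  forall phi : {linear X -> K^o}, continuous phi ->
    integral_is A (fun w => phi (F w)) (phi x).

Definition Pettis_integrable (F : T -> X) : Prop :=
  [/\ weakly_measurable F,
      (forall phi : {linear X -> K^o}, continuous phi ->
        in_L1 (fun w => phi (F w))) &
      (forall A, measurable A -> exists x, is_Pettis_integral A F x)].

(* the value at A is unique by the Hahn-Banach theorem *)
Definition Pettis_integral (A : set T) (F : T -> X) : X :=
  get [set x | is_Pettis_integral A F x].

Definition cut (B : set T) (F : T -> X) : T -> X := fun w => \1_B w *: F w.

Definition locally_Pettis_integrable (F : T -> X) : Prop :=
  weakly_measurable F /\
  forall B, finite_measurable B -> Pettis_integrable (cut B F).

Definition Pettis_set_function (F : T -> X) (B : set T) : X := Pettis_integral B (cut B F).

End Pettis.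
End measure_space.

(* Main.v *)
Require Import Defs.
From HB Require Import structures.
From mathcomp Require Import all_boot all_order all_algebra.
From mathcomp Require Import all_classical all_reals all_analysis measurable_realfun.
From mathcomp Require Import complex ring lra.

Set Implicit Arguments.
Unset Strict Implicit.
Unset Printing Implicit Defensive.

Import Order.TTheory GRing.Theory Num.Theory.
Import numFieldNormedType.Exports.

Local Open Scope classical_set_scope.
Local Open Scope ring_scope.

(** Write nu(B) for the Pettis integral of F over a set B of finite measure.
    The values nu(B) are determined by their images under the dual of X, which
    are integrals, so nu is finitely additive; and by assumption it is bounded.
    A bounded additive set function with values in a space without a copy of c0
    is strongly additive (Diestel and Faires): a sequence of disjoint sets on
    which its norm stays above some e > 0 would give vectors x_n of norm at
    least e with uniformly bounded finite subsums, and such a sequence has a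
    subsequence that spans a copy of c0 (Bessaga and Pelczynski).  It follows
    that there are increasing sets B_n of finite measure such that
    |nu(B)| <= 1/(n+1) as soon as B is disjoint from B_n
    ([additive_exhaustion]).

    Given a measurable A, the sequence nu(A `&` B_n) is then Cauchy; let x be
    its limit.  For a functional phi, boundedness of nu makes phi o F
    integrable, because phi o F vanishes a.e. outside a sigma-finite set on
    whose finite parts its integrals are the bounded numbers phi(nu(B)).  The
    integral of phi o F over A minus B_n is the limit of the values of phi o nu
    on sets of finite measure disjoint from B_n, so it is at most
    |phi|/(n+1); hence phi(x) is the integral of phi o F over A
    ([component_integral]), and x is the Pettis integral of F over A.

    The copy of c0 is obtained from norming functionals phi_n of the x_n.  The
    bound on the subsums bounds the sums of |phi_n(x_m)| over m, uniformly in
    n, and Rosenthal's lemma ([rosenthal]) selects a subsequence along which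
    the off-diagonal part of the matrix phi_n(x_m) is dominated by its
    diagonal; testing a combination of the x_m against phi_n then controls its
    n-th coefficient.  The norming functionals come from the Hahn-Banach
    theorem. *)

(** * Scalars and norms over either field *)

Section scalars.
Context (R : realType) (k : scalar_kind).
Local Notation K := (base_field R k).
Implicit Types z w : K.

Lemma re_additive : {morph @re R k : x y / x + y}.
Proof. by case: k => // -[a b] [c e]. Qed.

Lemma im_additive : {morph @im R k : x y / x + y}.
Proof. by case: k => [x y|[a b] [c e]] //=; rewrite addr0. Qed.

Lemma re_of_re_im (a b : R) : re (of_re_im k a b) = a.
Proof. by case: k. Qed.

Lemma ler_norm_im_of_re_im (a b : R) : `|im (of_re_im k a b)| <= `|b|.
Proof. by case: k => //=; rewrite normr0. Qed.

Lemma re0 : re (0 : K) = 0.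
Proof. by rewrite -(of_real0 R k) of_realK. Qed.

Lemma im0 : im (0 : K) = 0.
Proof. by case: k. Qed.

Lemma reB z w : re (z - w) = re z - re w.
Proof. by apply/eqP; rewrite eq_sym subr_eq -re_additive subrK. Qed.

Lemma imB z w : im (z - w) = im z - im w.
Proof. by apply/eqP; rewrite eq_sym subr_eq -im_additive subrK. Qed.

Lemma rnorm_scalar z : rnorm (z : K^o) = Num.sqrt (re z ^+ 2 + im z ^+ 2).
Proof.
case: k z => [z|z]; first by rewrite /rnorm/= expr0n addr0 sqrtr_sqr.
exact: (congr1 (@complex.Re R) (normc_def z)).
Qed.

Lemma ler_norm_re z : `|re z| <= rnorm (z : K^o).
Proof. by rewrite rnorm_scalar -sqrtr_sqr ler_wsqrtr// lerDl sqr_ge0. Qed.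

Lemma ler_norm_im z : `|im z| <= rnorm (z : K^o).
Proof. by rewrite rnorm_scalar -sqrtr_sqr ler_wsqrtr// lerDr sqr_ge0. Qed.

Lemma rnorm_le_re_im z : rnorm (z : K^o) <= `|re z| + `|im z|.
Proof.
rewrite rnorm_scalar -[leRHS]ger0_norm ?addr_ge0// -sqrtr_sqr ler_wsqrtr//.
rewrite sqrrD !real_normK ?num_real// addrAC lerDl.
by rewrite mulrn_wge0// mulr_ge0.
Qed.

Lemma of_real1 : of_real k 1 = 1 :> K.
Proof. by case: k. Qed.

Lemma of_realN (a : R) : of_real k (- a) = - of_real k a :> K.
Proof. by apply/eqP; rewrite -addr_eq0 -of_realD addNr of_real0. Qed.

Lemma rnormN (V : normedModType K) (x : V) : rnorm (- x) = rnorm x.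
Proof. by rewrite /rnorm normrN. Qed.

Lemma rnormB (V : normedModType K) (x y : V) : rnorm (x - y) = rnorm (y - x).
Proof. by rewrite -rnormN opprB. Qed.

Lemma rnorm0 (V : normedModType K) : rnorm (0 : V) = 0.
Proof. by rewrite /rnorm normr0 re0. Qed.

Lemma rnorm0_eq0 (V : normedModType K) (x : V) : rnorm x = 0 -> x = 0.
Proof. by move=> /(congr1 (of_real k)); rewrite rnormK of_real0 => /normr0_eq0. Qed.

Lemma rnorm_sum (V : normedModType K) (I : Type) (s : seq I) (f : I -> V) :
  rnorm (\sum_(i <- s) f i) <= \sum_(i <- s) rnorm (f i).
Proof.
elim: s => [|i s IH]; first by rewrite !big_nil rnorm0.
by rewrite !big_cons (le_trans (rnormD _ _))// lerD2l.
Qed.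

Lemma rnorm_of_real (a : R) : rnorm (of_real k a : K^o) = `|a|.
Proof.
rewrite rnorm_scalar of_realK (_ : im _ = 0) ?expr0n ?addr0 ?sqrtr_sqr//.
by case: k.
Qed.

Lemma continuous_rnorm_bound (V W : normedModType K) (f : {linear V -> W}) :
  continuous f -> exists2 C : R, 0 <= C & forall x, rnorm (f x) <= C * rnorm x.
Proof.
move=> /linear_bounded_continuous/linear_boundedP/pinfty_ex_gt0[M M0 fM].
exists (re M); first by rewrite -(of_real_le k) of_real0 ge0_of_re ltW.
move=> x; rewrite -(of_real_le k) of_realM !rnormK ge0_of_re ?fM//; exact: ltW.
Qed.

Lemma rnorm_bound_continuous (V W : normedModType K) (f : {linear V -> W}) (C : R) :
  (forall x, rnorm (f x) <= C * rnorm x) -> continuous f.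
Proof.
move=> fC; apply/linear_bounded_continuous/linear_boundedP.
have Cr : of_real k C \is Num.real.
  by rewrite realE -(of_real0 R k) !of_real_le -realE num_real.
exists (of_real k C); split=> // r /ltW Cr' x.
apply: le_trans (ler_wpM2r (normr_ge0 x) Cr').
by rewrite -(rnormK (f x)) -(rnormK x) -of_realM of_real_le.
Qed.

End scalars.

(** * The Hahn-Banach theorem *)

Section hahn_banach.
Context (R : realType) (k : scalar_kind) (V : lmodType (base_field R k)).
Local Notation K := (base_field R k).

(** Positive real multiples only, so that the notion is the same over both
    scalar fields and the argument below is that of a real vector space. *)
Definition sublinear (q : V -> R) :=
  (forall x y, q (x + y) <= q x + q y) /\
  (forall a x, 0 < a -> q (of_real k a *: x) <= a * q x).

Lemma sublinear_scale q a x : sublinear q -> 0 < a ->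
  q (of_real k a *: x) = a * q x.
Proof.
move=> [_ qZ] a0; apply/eqP; rewrite eq_le qZ//=.
have := qZ a^-1 (of_real k a *: x); rewrite invr_gt0 => /(_ a0).
rewrite scalerA -of_realM mulVf ?gt_eqF//.
by rewrite of_real1 scale1r ler_pdivlMl.
Qed.

Lemma sublinear0 q : sublinear q -> q 0 = 0.
Proof.
by move=> sq; have := @sublinear_scale q 2 0 sq; rewrite scaler0 ltr0n => /(_ isT); lra.
Qed.

Lemma sublinear_ge0 q x : sublinear q -> 0 <= q x + q (- x).
Proof. by move=> sq; rewrite -(sublinear0 sq) -(subrr x) sq.1. Qed.

(** For c <= q a, the largest sublinear functional below q whose value at [- a]
    is at most [- c]; a linear functional below it takes a value at least [c]
    at [a]. *)
Definition shift_inf (q : V -> R) (a : V) (c : R) (x : V) : R :=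
  inf [set q (x + of_real k t *: a) - t * c | t in [set t | 0 <= t]].

Section shift_inf.
Variables (q : V -> R) (a : V) (c : R).
Hypotheses (sq : sublinear q) (cq : c <= q a).

Lemma sublinear_scale0 t x : 0 <= t -> q (of_real k t *: x) = t * q x.
Proof.
rewrite le_eqVlt => /predU1P[<-|t0]; last exact: sublinear_scale.
by rewrite of_real0 scale0r mul0r (sublinear0 sq).
Qed.

Let has_inf_shift x :
  has_inf [set q (x + of_real k t *: a) - t * c | t in [set t | 0 <= t]].
Proof.
split; first by exists (q (x + of_real k 0 *: a) - 0 * c); exists 0 => /=.
exists (- q (- x)) => _ [t /= t0 <-].
have [qD _] := sq.
have := qD (x + of_real k t *: a) (- x).
rewrite addrAC subrr add0r sublinear_scale0//.
have := ler_wpM2l t0 cq; lra.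
Qed.

Lemma shift_inf_le x t : 0 <= t -> shift_inf q a c x <= q (x + of_real k t *: a) - t * c.
Proof. by move=> t0; apply: ge_inf; [exact: (has_inf_shift x).2 | exists t]. Qed.

Lemma shift_inf_le0 x : shift_inf q a c x <= q x.
Proof.
by have := shift_inf_le x (lexx 0); rewrite of_real0 scale0r addr0 mul0r subr0.
Qed.

Lemma shift_inf_sublinear : sublinear (shift_inf q a c).
Proof.
have [qD qZ] := sq; split.
  move=> x y; apply/ler_addgt0Pl => e e0.
  have e2 : 0 < e / 2 by rewrite divr_gt0.
  have [_ [s /= s0 <-] hs] := inf_adherent e2 (has_inf_shift x).
  have [_ [t /= t0 <-] ht] := inf_adherent e2 (has_inf_shift y).
  have := shift_inf_le (x + y) (addr_ge0 s0 t0).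
  have := qD (x + of_real k s *: a) (y + of_real k t *: a).
  rewrite addrACA -scalerDl -of_realD.
  rewrite -/(shift_inf q a c x) in hs; rewrite -/(shift_inf q a c y) in ht.
  lra.
move=> b x b0; rewrite -ler_pdivrMl//; apply: lb_le_inf.
  exact: (has_inf_shift x).1.
move=> _ [t /= t0 <-]; rewrite ler_pdivrMl//.
apply: le_trans (shift_inf_le _ (mulr_ge0 (ltW b0) t0)) _.
by rewrite of_realM -scalerA -scalerDr sublinear_scale// mulrBr mulrA.
Qed.

End shift_inf.

(** Zorn's lemma on total functions instead of partially defined linear ones:
    the pointwise infimum of a chain of sublinear functionals below p is finite,
    since each of them is at least [- p (- x)] at x, and it is sublinear because
    two approximate infima are attained by comparable members. *)
Lemma minimal_sublinear p : sublinear p -> exists q, [/\ sublinear q,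
  forall x, q x <= p x &
  forall q', sublinear q' -> (forall x, q' x <= q x) -> q' = q].
Proof.
move=> sp.
pose T := {q : V -> R | sublinear q /\ forall x, q x <= p x}.
pose below (q r : T) := `[< forall x, sval r x <= sval q x >].
have [||||q qmin] := @Zorn T below.
- by move=> q; apply/asboolP.
- move=> q r s /asboolP qr /asboolP rs; apply/asboolP => x.
  exact: le_trans (rs x) (qr x).
- move=> [q Hq] [r Hr] /asboolP/= qr /asboolP/= rq; apply: eq_exist.
  by apply/funext => x; apply/eqP; rewrite eq_le rq qr.
- move=> A Atot; have [[q0 Aq0]|/forallNP A0] := pselect (exists q, A q); last first.
    have Hp : sublinear p /\ forall x, p x <= p x by [].
    by exists (exist _ p Hp) => q /A0.
  pose E x := [set sval q x | q in A].
  have Einf x : has_inf (E x).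
    split; first by exists (sval q0 x); exists q0.
    exists (- p (- x)) => _ [[q [sq qp]] _ <-] /=.
    have := sublinear_ge0 x sq; have := qp (- x); lra.
  pose m x := inf (E x).
  have mle q x : A q -> m x <= sval q x.
    by move=> Aq; apply: ge_inf; [exact: (Einf x).2 | exists q].
  have sm : sublinear m.
    split.
      move=> x y; apply/ler_addgt0Pl => e e0.
      have e2 : 0 < e / 2 by rewrite divr_gt0.
      have [_ [q Aq <-] hq] := inf_adherent e2 (Einf x).
      have [_ [r Ar <-] hr] := inf_adherent e2 (Einf y).
      rewrite -/(m x) in hq; rewrite -/(m y) in hr.
      have [/asboolP qr|/asboolP rq] := Atot _ _ Aq Ar.
        have := mle _ (x + y) Ar; have := (svalP r).1.1 x y; have := qr x; lra.
      have := mle _ (x + y) Aq; have := (svalP q).1.1 x y; have := rq y; lra.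
    move=> b x b0; rewrite -ler_pdivrMl//; apply: lb_le_inf.
      exact: (Einf x).1.
    move=> _ [q Aq <-]; rewrite ler_pdivrMl//.
    by apply: le_trans (mle _ _ Aq) _; exact: (svalP q).1.2.
  have Hm : sublinear m /\ forall x, m x <= p x.
    by split=> // x; apply: le_trans (mle _ x Aq0) _; exact: (svalP q0).2.
  by exists (exist _ m Hm) => q Aq; apply/asboolP => x /=; exact: mle.
- exists (sval q); have [sq qp] := svalP q; split=> // q' sq' q'q.
  have Hq' : sublinear q' /\ forall x, q' x <= p x.
    by split=> // x; exact: le_trans (q'q x) (qp x).
  have := qmin (exist _ q' Hq'); rewrite /below/=.
  by move=> /(_ (introT (asboolP _) q'q)) <-.
Qed.

(** A minimal sublinear functional f is additive: lowering f to [shift_inf f y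
    (f y)] does not change it, which reads f x <= f (x + y) - f y.  Starting
    from [shift_inf p x0 (p x0)] instead of p forces the value at x0. *)
Theorem hahn_banach p x0 : sublinear p -> exists f : V -> R,
  [/\ {morph f : x y / x + y}, forall a x, f (of_real k a *: x) = a * f x,
      forall x, f x <= p x & f x0 = p x0].
Proof.
move=> sp.
have sp' : sublinear (shift_inf p x0 (p x0)) by exact: shift_inf_sublinear.
have [f [sf fp' fmin]] := minimal_sublinear sp'.
have fp x : f x <= p x by apply: le_trans (fp' x) _; exact: shift_inf_le0.
have fD : {morph f : x y / x + y}.
  move=> x y; apply/eqP; rewrite eq_le sf.1/=.
  have <- : shift_inf f y (f y) = f.
    by apply: fmin; [exact: shift_inf_sublinear | move=> z; exact: shift_inf_le0].
  have := @shift_inf_le f y (f y) sf (lexx _) x 1 ler01.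
  rewrite of_real1 scale1r mul1r.
  have -> : shift_inf f y (f y) = f.
    by apply: fmin; [exact: shift_inf_sublinear | move=> z; exact: shift_inf_le0].
  lra.
have f0 : f 0 = 0 := sublinear0 sf.
have fN x : f (- x) = - f x.
  by have := fD x (- x); rewrite subrr f0; lra.
exists f; split=> //.
  move=> a x; have [a0|a0] := leP 0 a; first exact: sublinear_scale0.
  rewrite -[a]opprK of_realN scaleNr fN sublinear_scale0 ?mulNr//.
  by rewrite oppr_ge0 ltW.
apply/eqP; rewrite eq_le fp/=.
have := le_trans (fp' (- x0)) (@shift_inf_le p x0 (p x0) sp (lexx _) (- x0) 1 ler01).
rewrite of_real1 scale1r addNr mul1r (sublinear0 sp) fN; lra.
Qed.

End hahn_banach.

(** * Norming functionals *)

(** Over the complex scalars this is x |-> f(x) - i f(i x), the complex-linear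
    functional with real part f; over the real scalars it is f itself. *)
Definition complexify (R : realType) (k : scalar_kind)
    (V : lmodType (base_field R k)) (f : V -> R) (x : V) : (base_field R k)^o :=
  of_re_im k (f x) (- f (of_re_im k 0 1 *: x)).

Lemma complexify_linear (R : realType) (k : scalar_kind)
    (V : lmodType (base_field R k)) (f : V -> R) :
  {morph f : x y / x + y} -> (forall a x, f (of_real k a *: x) = a * f x) ->
  linear (complexify f).
Proof.
case: k V f => V f fD fZ z x y; rewrite /complexify/=.
  by rewrite fD (fZ z).
rewrite scalerDr !fD; case: z => a b.
have fab u : f (Complex a b *: u) = a * f u + b * f (Complex 0 1 *: u).
  rewrite -(fZ a) -(fZ b) -fD scalerA -scalerDl; congr (f (_ *: _)).
  by apply/eqP; rewrite eq_complex/=; apply/andP; split; apply/eqP; ring.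
have -> : Complex 0 1 *: (Complex a b *: x) = Complex a b *: (Complex 0 1 *: x).
  by rewrite !scalerA mulrC.
rewrite !fab scalerA (_ : Complex 0 1 * Complex 0 1 = of_real ComplexScalars (-1)).
  by rewrite fZ; apply/eqP; rewrite eq_complex/=; apply/andP; split; apply/eqP; ring.
by apply/eqP; rewrite eq_complex/=; apply/andP; split; apply/eqP; ring.
Qed.

(** The factor 2 is the crude bound of a complex number by its two components;
    only some uniform bound matters in the sequel. *)
Lemma norming_functional (R : realType) (k : scalar_kind)
    (X : normedModType (base_field R k)) (x0 : X) :
  exists phi : {linear X -> (base_field R k)^o},
    (forall x, rnorm (phi x) <= 2 * rnorm x) /\ re (phi x0) = rnorm x0.
Proof.
have sp : sublinear (fun x : X => rnorm x).
  split=> [x y|a x a0]; first exact: rnormD.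
  by rewrite rnormZ rnorm_of_real gtr0_norm.
have [f [fD fZ fp f0]] := hahn_banach x0 sp.
have fN x : f (- x) = - f x.
  by rewrite -scaleN1r -[in RHS](mulN1r (f x)) -fZ of_realN of_real1.
have f_norm x : `|f x| <= rnorm x.
  by rewrite ler_norml fp andbT lerNl -fN -(rnormN x) fp.
pose L := GRing.isLinear.Build _ _ _ _ _ (complexify_linear fD fZ).
exists (HB.pack (complexify f) L : {linear X -> (base_field R k)^o}).
split; last by rewrite /= re_of_re_im.
move=> x /=; apply: le_trans (rnorm_le_re_im _) _.
rewrite re_of_re_im mulrDl mul1r lerD//.
apply: le_trans (ler_norm_im_of_re_im _ _ _) _.
rewrite normrN (le_trans (f_norm _))// rnormZ ler_piMl ?rnorm_ge0//.
by rewrite rnorm_scalar re_of_re_im expr0n add0r sqrtr_sqr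
  (le_trans (ler_norm_im_of_re_im _ _ _))// normr1.
Qed.

(** * Rosenthal's lemma *)

Section rosenthal.
Context (R : realType).
Implicit Types a : nat -> nat -> R.

Definition offdiag_bounded a (C : R) := forall n s, uniq s -> n \notin s ->
  \sum_(m <- s) a n m <= C.

(** Rosenthal's lemma, by induction on the number p of times delta fits into C.
    Split the indices into infinitely many infinite cells.  If the restriction
    to no cell satisfies the bound delta, each cell q contains an index b q with
    an off-diagonal sum above delta inside the cell; then the off-diagonal sums
    along b, which only meets each cell once, are bounded by C - delta, and the
    induction hypothesis applies. *)
Lemma rosenthal a (delta C : R) : 0 < delta -> offdiag_bounded a C ->
  exists2 h : nat -> nat, injective h &
    offdiag_bounded (fun n m => a (h n) (h m)) delta.
Proof.
move=> d0 aC.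
have [p Cp] : exists p : nat, C <= p%:R * delta.
  exists (Num.truncn (C / delta)).+1; rewrite -ler_pdivrMr//.
  by apply/ltW; rewrite truncnS_gt.
elim: p a C aC Cp => [|p IH] a C aC Cp.
  exists id => // n s us ns; apply: le_trans (aC n s us ns) _.
  by rewrite (le_trans Cp)// mul0r ltW.
pose cell (q j : nat) : nat := pickle (q, j).
have cell_inj q j q' j' : cell q j = cell q' j' -> q = q' /\ j = j'.
  by move/(pcan_inj pickleK) => [].
have [[q good]|/forallNP bad] := pselect (exists q,
    offdiag_bounded (fun n m => a (cell q n) (cell q m)) delta).
  by exists (cell q) => // i j /cell_inj[].
have {}bad q : exists js : nat * seq nat, [/\ uniq js.2, js.1 \notin js.2 &
    delta < \sum_(m <- js.2) a (cell q js.1) (cell q m)].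
  have /existsNP[j /existsNP[s]] := bad q.
  move=> /not_implyP[us /not_implyP[js /negP]]; rewrite -ltNge => ds.
  by exists (j, s).
have [js jsP] := choice bad.
pose b q := cell q (js q).1.
have b_inj : injective b by move=> q q' /cell_inj[].
have bC : offdiag_bounded (fun q q' => a (b q) (b q')) (C - delta).
  move=> q s us qs; have [ut jt ds] := jsP q.
  have := aC (b q) (map b s ++ map (cell q) (js q).2).
  have cq_inj : injective (cell q) by move=> i j /cell_inj[].
  rewrite cat_uniq (map_inj_uniq b_inj) us (map_inj_uniq cq_inj) ut andbT.
  have -> : ~~ has (in_mem^~ (mem (map b s))) (map (cell q) (js q).2).
    apply/hasPn => _ /mapP[j _ ->]; apply/negP => /mapP[q' q's /cell_inj[qq' _]].
    by move: qs; rewrite qq' q's.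
  have -> : b q \notin map b s ++ map (cell q) (js q).2.
    rewrite mem_cat mem_map// (negbTE qs)/=.
    by apply: contra jt => /mapP[j jt /cell_inj[_ ->]].
  move=> /(_ isT isT); rewrite big_cat !big_map/=; move: ds.
  by rewrite -/(b q); lra.
have [|h h_inj hP] := IH _ _ bC.
  by rewrite lerBlDr (le_trans Cp)// -natr1 mulrDl mul1r.
by exists (b \o h) => //; exact: inj_comp.
Qed.

End rosenthal.

(** * Sequences in a normed space, with real-valued norms *)

Lemma re_gt0 (R : realType) (k : scalar_kind) (z : base_field R k) :
  0 < z -> 0 < re z.
Proof.
move=> z0; have zE := ge0_of_re (ltW z0).
rewrite lt_neqAle -(of_real_le k) of_real0 zE ltW// andbT eq_sym.
by apply: contraTN z0 => /eqP z0; rewrite -zE z0 of_real0 ltxx.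
Qed.

Section rnorm_limits.
Context (R : realType) (k : scalar_kind) (X : normedModType (base_field R k)).
Implicit Types u : nat -> X.

Lemma cvg_rnormP u l : u @ \oo --> l <->
  forall e : R, 0 < e -> exists N, forall n, (N <= n)%N -> rnorm (l - u n) <= e.
Proof.
split=> [/cvgrPdist_le ul e e0|ul].
  have [|N _ uN] := ul (of_real k e).
    rewrite lt_neqAle -(of_real0 R k) of_real_le ltW// andbT.
    by rewrite (can_eq (@of_realK R k)) lt_eqF.
  by exists N => n /uN /=; rewrite -rnormK of_real_le.
apply/cvgrPdist_le => e e0; have [|N uN] := ul (re e).
  exact: re_gt0.
by exists N => // n /uN /=; rewrite -(of_real_le k) rnormK ge0_of_re// ltW.
Qed.

Lemma rnorm_lim_le u l M : u @ \oo --> l -> (forall n, rnorm (u n) <= M) ->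
  rnorm l <= M.
Proof.
move=> /cvg_rnormP ul uM; apply/ler_addgt0Pl => e e0; have [N uN] := ul _ e0.
rewrite -(subrK (u N) l) (le_trans (rnormD _ _))// lerD//; exact: uN.
Qed.

Lemma rnorm_lim_ge u l M N : u @ \oo --> l ->
  (forall n, (N <= n)%N -> M <= rnorm (u n)) -> M <= rnorm l.
Proof.
move=> /cvg_rnormP ul uM; apply/ler_addgt0Pl => e e0; have [N' uN] := ul _ e0.
apply: le_trans (uM _ (leq_maxl N N')) _.
rewrite -{1}(subrK l (u (maxn N N'))) (le_trans (rnormD _ _))// lerD//.
by rewrite rnormB uN// leq_maxr.
Qed.

End rnorm_limits.

Lemma cauchy_rnorm_cvg (R : realType) (k : scalar_kind)
    (X : completeNormedModType (base_field R k)) (u : nat -> X) :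
  (forall e : R, 0 < e -> exists N, forall n m, (N <= n)%N -> (n <= m)%N ->
     rnorm (u m - u n) <= e) -> cvg (u @ \oo).
Proof.
move=> uC; apply/cauchy_cvgP/cauchy_exP => e e0.
have re0 := re_gt0 e0; have [|N uN] := uC (re e / 2); first by rewrite divr_gt0.
exists (u N); exists N => // m /= Nm; rewrite -ball_normE/= distrC.
rewrite -rnormK -[e]ge0_of_re ?ltW// lt_neqAle of_real_le (can_eq (@of_realK R k)).
rewrite -lt_neqAle (le_lt_trans (uN _ _ (leqnn _) Nm))//; lra.
Qed.

(** * Sequences with bounded subsums and copies of c0 *)

Section copy_of_c0.
Context (R : realType) (k : scalar_kind) (X : completeNormedModType (base_field R k)).
Local Notation K := (base_field R k).
Variables (x : nat -> X) (C : R).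
Hypothesis xC : forall s, uniq s -> rnorm (\sum_(i <- s) x i) <= C.

(** Group the terms by the sign of [f (x i)]: each group is the image under f of
    a subsum of the x i. *)
Lemma sum_norm_real (f : X -> R) c : {morph f : y z / y + z} ->
  (forall y, `|f y| <= c * rnorm y) -> 0 <= c ->
  forall s, uniq s -> \sum_(i <- s) `|f (x i)| <= c * C *+ 2.
Proof.
move=> fD fc c0 s us.
have f0 : f 0 = 0 by have := fD 0 0; rewrite addr0; lra.
have fsum t : f (\sum_(i <- t) x i) = \sum_(i <- t) f (x i).
  elim: t => [|i t IH]; first by rewrite !big_nil.
  by rewrite !big_cons fD IH.
have bnd (P : pred nat) : `|\sum_(i <- s | P i) f (x i)| <= c * C.
  rewrite -big_filter -fsum (le_trans (fc _))// ler_wpM2l//.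
  by rewrite xC// filter_uniq.
rewrite (bigID (fun i => 0 <= f (x i)))/= mulr2n lerD//.
  rewrite (eq_bigr (fun i => f (x i))) => [|i /ger0_norm//].
  by rewrite (le_trans (ler_norm _)).
rewrite (eq_bigr (fun i => - f (x i))) => [|i]; last first.
  by rewrite -ltNge => /ltr0_norm.
by rewrite sumrN (le_trans (ler_norm _))// normrN.
Qed.

Lemma sum_norm_functional (phi : {linear X -> K^o}) c :
  (forall y, rnorm (phi y) <= c * rnorm y) -> 0 <= c ->
  forall s, uniq s -> \sum_(i <- s) rnorm (phi (x i)) <= c * C *+ 4.
Proof.
move=> phic c0 s us.
apply: (@le_trans _ _ (\sum_(i <- s) (`|re (phi (x i))| + `|im (phi (x i))|))).
  by apply: ler_sum => i _; exact: rnorm_le_re_im.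
rewrite big_split/= (mulrnA _ 2 2) (mulr2n (_ *+ 2)) lerD//.
- apply: (sum_norm_real (f := fun y => re (phi y))) => // [y z|y].
    by rewrite linearD/= re_additive.
  by apply: le_trans (phic y); exact: ler_norm_re.
- apply: (sum_norm_real (f := fun y => im (phi y))) => // [y z|y].
    by rewrite linearD/= im_additive.
  by apply: le_trans (phic y); exact: ler_norm_im.
Qed.

(** Test the combination against a functional that norms it. *)
Lemma rnorm_comb_le (b : nat -> K) M s : uniq s -> 0 <= M ->
  (forall i, i \in s -> rnorm (b i : K^o) <= M) ->
  rnorm (\sum_(i <- s) b i *: x i) <= M * (C *+ 8).
Proof.
move=> us M0 bM; set y := \sum_(i <- s) _.
have [phi [phi2 <-]] := norming_functional y.
apply: le_trans (ler_norm _) _; apply: le_trans (ler_norm_re _) _.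
rewrite /y linear_sum (le_trans (rnorm_sum _ _))//.
apply: (@le_trans _ _ (M * \sum_(i <- s) rnorm (phi (x i)))).
  rewrite mulr_sumr big_seq_cond [leRHS]big_seq_cond; apply: ler_sum => i.
  by rewrite andbT => si; rewrite linearZ/= rnormZ ler_wpM2r ?rnorm_ge0 ?bM.
rewrite ler_wpM2l// (le_trans (sum_norm_functional phi2 _ us))//.
by rewrite mulr_natl -mulrnA.
Qed.

End copy_of_c0.

(** The two estimates on the vectors y i say that finite combinations of them are
    comparable with the sup norm of their coefficients; the lower one is stated
    coefficient by coefficient, with an error of half the sup norm that is
    absorbed on passing to the supremum. *)
Section c0_embedding.
Context (R : realType) (k : scalar_kind) (X : completeNormedModType (base_field R k)).
Local Notation K := (base_field R k).
Variables (y : nat -> X) (D c : R).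
Hypothesis D0 : 0 <= D.
Hypothesis c_gt0 : 0 < c.
Hypothesis y_le : forall (b : nat -> K) M s, uniq s -> 0 <= M ->
  (forall i, i \in s -> rnorm (b i : K^o) <= M) ->
  rnorm (\sum_(i <- s) b i *: y i) <= M * D.
Hypothesis y_ge : forall (b : nat -> K) M s n, uniq s -> n \in s -> 0 <= M ->
  (forall i, i \in s -> rnorm (b i : K^o) <= M) ->
  c * (rnorm (b n : K^o) - M / 2) <= rnorm (\sum_(i <- s) b i *: y i).
Implicit Types a b : c0 R k.

Let S a := series (fun i => a i *: y i).

Let S_cvg a : cvg (S a @ \oo).
Proof.
apply: cauchy_rnorm_cvg => e e0.
have d0 : 0 < e / (D + 1) by rewrite divr_gt0// ltr_wpDl.
have [N aN] := (cvg_rnormP (X := K^o) _ _).1 (c0_cvg a) _ d0.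
exists N => n m Nn nm; rewrite /S sub_series_geq//.
apply: le_trans (y_le (M := e / (D + 1)) (iota_uniq _ _) (ltW d0) _) _.
  move=> i; rewrite mem_index_iota => /andP[ni _].
  by have := aN i (leq_trans Nn ni); rewrite sub0r rnormN.
by rewrite mulrAC ler_pdivrMr ?ltr_wpDl// ler_wpM2l ?(ltW e0)// lerDl.
Qed.

Definition c0_sum a : X := lim (S a @ \oo).

Let c0_sumP a : S a @ \oo --> c0_sum a.
Proof. exact: S_cvg. Qed.

Lemma c0_sum_linear : linear c0_sum.
Proof.
move=> z a b; apply/cvg_lim; first exact: norm_hausdorff.
rewrite (_ : S _ = (fun n => z *: S a n + S b n)).
  by apply: cvgD; [exact: cvgZl_tmp|].
apply/funext => n; rewrite /S /series/= scaler_sumr -big_split/=.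
by apply: eq_bigr => i _; rewrite scalerDl scalerA.
Qed.

HB.instance Definition _ :=
  GRing.isLinear.Build K (c0 R k) X _ c0_sum c0_sum_linear.

Lemma c0_sum_le a : rnorm (c0_sum a) <= D * rnorm a.
Proof.
have := @rnorm_lim_le R k X (S a) (c0_sum a) (D * rnorm a) (@c0_sumP a).
apply => n; rewrite mulrC.
apply: y_le => [||i _]; [exact: iota_uniq|exact: rnorm_ge0|].
by rewrite rnorm_c0; exact: c0_rnorm_ub.
Qed.

Lemma c0_sum_ge a : c / 2 * rnorm a <= rnorm (c0_sum a).
Proof.
suff : rnorm a <= rnorm (c0_sum a) / c + rnorm a / 2.
  by rewrite mulrAC -mulrA -ler_pdivlMl// [c^-1 * _]mulrC; lra.
rewrite {1}rnorm_c0; apply: c0_rnorm_le => n.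
rewrite -lerBlDr ler_pdivlMr// mulrC.
apply: (rnorm_lim_ge (@c0_sumP a) (N := n.+1)) => m nm.
apply: y_ge => [||| i _]; [exact: iota_uniq| |exact: rnorm_ge0|].
  by rewrite mem_index_iota.
by rewrite rnorm_c0; exact: c0_rnorm_ub.
Qed.

(** Continuity of the inverse on the range is the lower bound [c0_sum_ge]. *)
Lemma c0_embedding : contains_copy X (c0 R k).
Proof.
have inj : injective c0_sum.
  move=> a b ab; apply/eqP; rewrite -subr_eq0; apply/eqP/rnorm0_eq0.
  have := c0_sum_ge (a - b); rewrite linearB/= ab subrr rnorm0.
  rewrite pmulr_rle0 ?divr_gt0// => ab0.
  by apply/eqP; rewrite eq_le ab0 rnorm_ge0.
pose g z := xget (0 : c0 R k) [set a | c0_sum a = z].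
have sumK : cancel c0_sum g.
  by move=> a; apply/inj/(@xgetPex _ 0 [set b | c0_sum b = c0_sum a]); exists a.
exists c0_sum, g; split=> //.
  by apply: (@rnorm_bound_continuous R k _ _ _ D); exact: c0_sum_le.
apply/subspace_continuousP => _ [a _ <-].
rewrite /from_subspace sumK.
apply/cvgrPdist_le => e e0; apply/nbhs_normP.
exists (of_real k (c / 2) * e) => /=.
  rewrite mulr_gt0// lt_neqAle -(of_real0 R k) of_real_le.
  by rewrite (can_eq (@of_realK R k)) lt_eqF ?ltW ?divr_gt0.
move=> _ /= /[swap] -[b _ <-]; rewrite sumK -linearB => ab.
have c2 : 0 < c / 2 by rewrite divr_gt0.
have eE := ge0_of_re (ltW e0).
rewrite -(rnormK (a - b)) -eE of_real_le -(ler_pM2l c2).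
apply: le_trans (c0_sum_ge _) _.
by rewrite -(of_real_le k) rnormK of_realM eE ltW.
Qed.

End c0_embedding.

(** The Bessaga-Pelczynski theorem in the case of a sequence bounded away from 0.
    Rosenthal's lemma is applied to the matrix of norms of phi_n(x_m), where
    phi_n norms x_n, with delta = e / 2: along the subsequence phi_n sees the
    n-th coefficient of a combination with weight at least e, and all the others
    together with weight at most e / 2. *)
Lemma bounded_sums_copy_c0 (R : realType) (k : scalar_kind)
    (X : completeNormedModType (base_field R k)) (x : nat -> X) (C e : R) :
  (forall s, uniq s -> rnorm (\sum_(i <- s) x i) <= C) ->
  0 < e -> (forall n, e <= rnorm (x n)) -> contains_copy X (c0 R k).
Proof.
move=> xC e0 xe.
have [phi phiP] := choice (fun n => norming_functional (x n)).
have [| |h h_inj hP] := @rosenthal R (fun n m => rnorm (phi n (x m))) (e / 2) (2 * C *+ 4).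
- by rewrite divr_gt0.
- by move=> n s us _; exact: (sum_norm_functional xC (phiP n).1).
have C0 : 0 <= C by have := xC [::] isT; rewrite big_nil rnorm0.
have yC s : uniq s -> rnorm (\sum_(i <- s) x (h i)) <= C.
  by move=> us; rewrite -(big_map h predT x) xC// map_inj_uniq.
apply: (@c0_embedding R k X (x \o h) (C *+ 8) (e / 2)).
- by rewrite mulrn_wge0.
- by rewrite divr_gt0.
- by move=> b M s; exact: rnorm_comb_le.
move=> b M s n us ns M0 bM.
have [phi2 phin] := phiP (h n).
set z := \sum_(i <- s) _.
suff H : e * rnorm (b n : _^o) - M * (e / 2) <= rnorm (phi (h n) z).
  have := phi2 z; lra.
rewrite lerBlDr.
have -> : phi (h n) z = phi (h n) (b n *: x (h n)) +
    \sum_(i <- rem n s) phi (h n) (b i *: x (h i)).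
  by rewrite linear_sum (perm_big _ (perm_to_rem ns)) big_cons.
set t := \sum_(i <- rem n s) _.
apply: (@le_trans _ _ (rnorm (phi (h n) (b n *: x (h n))))).
  rewrite linearZ rnormZ mulrC ler_wpM2l ?rnorm_ge0// (le_trans (xe (h n)))//.
  by rewrite -phin (le_trans (ler_norm _))// ler_norm_re.
rewrite -[X in rnorm X <= _](addrK t) (le_trans (rnormD _ _))// lerD2l rnormN.
apply: (le_trans (rnorm_sum _ _)).
apply: (@le_trans _ _ (M * \sum_(i <- rem n s) rnorm (phi (h n) (x (h i))))).
  rewrite mulr_sumr big_seq_cond [leRHS]big_seq_cond; apply: ler_sum => i.
  rewrite andbT => /mem_rem si.
  by rewrite linearZ rnormZ ler_wpM2r ?rnorm_ge0 ?bM.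
rewrite ler_wpM2l// hP ?rem_uniq//.
by rewrite mem_rem_uniq// inE eqxx.
Qed.

(** * Strong additivity of bounded additive set functions *)

(** The Diestel-Faires theorem.  If no B0 works, sets outside the union of the
    previous ones can be chosen one after the other with norm above e, and
    their images satisfy the hypotheses of [bounded_sums_copy_c0]. *)
Lemma additive_exhaustion (R : realType) (k : scalar_kind)
    (X : completeNormedModType (base_field R k)) (T : Type)
    (S : set (set T)) (nu : set T -> X) (C e : R) :
  S set0 -> (forall A B, S A -> S B -> S (A `|` B)) ->
  (forall A B, S A -> S B -> A `&` B = set0 -> nu (A `|` B) = nu A + nu B) ->
  (forall A, S A -> rnorm (nu A) <= C) ->
  ~ contains_copy X (c0 R k) -> 0 < e ->
  exists2 B0, S B0 & forall B, S B -> B `&` B0 = set0 -> rnorm (nu B) <= e.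
Proof.
move=> S0 SU nuU nuC noc0 e0; apply: contrapT => noB.
have next U : exists B, S U -> [/\ S B, B `&` U = set0 & e < rnorm (nu B)].
  have [SU'|nSU] := pselect (S U); last by exists set0.
  apply: contrapT => /forallNP noU; apply: noB; exists U => // B SB BU.
  by rewrite leNgt; apply/negP => eB; apply: (noU B) => _.
have [G GP] := choice next.
pose U n := iter n (fun U => U `|` G U) set0.
have SUn n : S (U n) by elim: n => //= n Sn; have [Sg _ _] := GP _ Sn; exact: SU.
pose A n := G (U n).
have SA n : S (A n) by have [] := GP _ (SUn n).
have AU n m : (n < m)%N -> A n `<=` U m.
  elim: m => // m IH; rewrite ltnS leq_eqVlt => /predU1P[->|/IH nm] /=.
    exact: subsetUr.
  by apply: subset_trans nm _; exact: subsetUl.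
have dis n m : (n < m)%N -> A n `&` A m = set0.
  move=> nm; have [_ mU _] := GP _ (SUn m).
  by rewrite -subset0 => x [/(AU _ _ nm) Ux Ax]; rewrite -mU.
have disj n m : n != m -> A n `&` A m = set0.
  by rewrite neq_ltn => /orP[/dis //|/dis]; rewrite setIC.
have nu0 : nu set0 = 0.
  have := nuU _ _ S0 S0 (setI0 _); rewrite setU0 => /eqP.
  by rewrite -subr_eq subrr eq_sym => /eqP.
have sumA s : uniq s -> S (\big[setU/set0]_(i <- s) A i) /\
    nu (\big[setU/set0]_(i <- s) A i) = \sum_(i <- s) nu (A i).
  elim: s => [|i s IH]; first by rewrite !big_nil.
  move=> /= /andP[is_ /IH[Ss nus]]; rewrite !big_cons; split; first exact: SU.
  rewrite nuU ?nus// big_distrr/= big_seq big1// => j js.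
  by apply: disj; apply: contraNneq is_ => ->.
apply: noc0; apply: (@bounded_sums_copy_c0 R k X (nu \o A) C e) => //.
- by move=> s us; have [Ss <-] := sumA s us; exact: nuC.
- by move=> n; have [_ _ /ltW] := GP _ (SUn n).
Qed.

Lemma eq_of_functionals (R : realType) (k : scalar_kind)
    (X : normedModType (base_field R k)) (x y : X) :
  (forall phi : {linear X -> (base_field R k)^o}, continuous phi -> phi x = phi y) ->
  x = y.
Proof.
move=> xy; apply/eqP; rewrite -subr_eq0; apply/eqP/rnorm0_eq0.
have [phi [phi2 <-]] := norming_functional (x - y).
by rewrite linearB/= xy ?subrr ?re0//; exact: rnorm_bound_continuous phi2.
Qed.

(** * Measurable versions of strongly measurable functions *)

Section versions.
Context (R : realType) (d : measure_display) (T : measurableType d).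
Variable mu : {measure set T -> \bar R}.
Local Notation Sf := (finite_measurable mu).

Lemma finite_measurable0 : Sf set0.
Proof. by split=> //; rewrite measure0 ltry. Qed.

Lemma finite_measurableU A B : Sf A -> Sf B -> Sf (A `|` B).
Proof.
move=> [mA fA] [mB fB]; split; first exact: measurableU.
apply: le_lt_trans (lte_add_pinfty fA fB); exact: measureU2.
Qed.

Lemma finite_measurable_sub A B : Sf B -> measurable A -> A `<=` B -> Sf A.
Proof.
move=> [mB fB] mA AB; split=> //; apply: le_lt_trans fB.
by apply: le_measure => //; rewrite inE.
Qed.

Context (k : scalar_kind).
Local Notation K := (base_field R k).

Lemma finite_range_measurable (s : T -> K) (f : K -> R) :
  finite_set (range s) -> (forall v, measurable (s @^-1` [set v])) ->
  measurable_fun setT (f \o s).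
Proof.
move=> fs ms _ /= Y mY; rewrite setTI.
rewrite (_ : _ @^-1` Y = \bigcup_(v in range s `&` f @^-1` Y) (s @^-1` [set v])).
  apply: fin_bigcup_measurable => //.
  exact: sub_finite_set fs.
apply/seteqP; split => [x Yx|x [v [_ Yv] /= sv]].
  by exists (s x) => //; split=> //; exists x.
by rewrite /preimage/= sv.
Qed.

(** Redefine f as 0 on a measurable null set outside which the simple functions
    s n converge to it.  The version then is the limit of the s n cut off there,
    and vanishes outside the union of the supports of the s n, which have finite
    measure. *)
Lemma strongly_measurable_version (f : T -> K^o) : strongly_measurable mu f ->
  exists (g : T -> K) (D : nat -> set T), 
  [/\ measurable_fun setT (fun x => re (g x)),
      measurable_fun setT (fun x => im (g x)),
      {ae mu, forall x, f x = g x},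
      forall n, Sf (D n) & nondecreasing_seq D /\
        forall x, ~ (\bigcup_n D n) x -> g x = 0].
Proof.
move=> [s [sP [N [mN N0 sN]]]].
pose g x : K := if x \in N then 0 else f x.
have sg x : x \notin N -> s n x @[n --> \oo] --> g x.
  move=> xN; rewrite /g (negbTE xN); apply: contrapT => sx; move: xN.
  by rewrite mem_set//; exact: sN.
have msN (p : K -> R) : p 0 = 0 -> (forall n, measurable_fun setT
    (fun x => if x \in N then 0 else p (s n x))).
  move=> p0 n; apply: measurable_fun_ifT.
  - by apply: (measurable_fun_bool true); rewrite setTI preimage_mem_true.
  - exact: measurable_cst.
  - have [fs ms _] := sP n; exact: finite_range_measurable.
have mg (p : K -> R) : (forall z w, `|p z - p w| <= rnorm (z - w : K^o)) -> p 0 = 0 ->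
    measurable_fun setT (fun x => p (g x)).
  move=> pl p0; apply: (measurable_fun_cvg (msN p p0)) => x _.
  have [xN|xN] := boolP (x \in N); first by rewrite /g xN p0; exact: cvg_cst.
  apply/cvgrPdist_le => e e0; have [n nP] := (cvg_rnormP (X := K^o) _ _).1 (sg x xN) e e0.
  by exists n => // m /nP sm /=; apply: le_trans sm; exact: pl.
pose D n := [set x | s n x != 0].
exists g, (fun n => \big[setU/set0]_(i < n.+1) D i); split.
- apply: mg; last exact: re0.
  by move=> z w; rewrite -reB; exact: ler_norm_re.
- apply: mg; last exact: im0.
  by move=> z w; rewrite -imB; exact: ler_norm_im.
- exists N; split=> // x /= gx; apply: contrapT => xN; apply: gx.
  by rewrite /g memNset.
- have SD n : Sf (D n).
    have [fs ms fin] := sP n; split=> //.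
    rewrite (_ : D n = ~` (s n @^-1` [set 0])); first exact: measurableC.
    by apply/seteqP; split=> x /= /eqP.
  move=> n; apply: big_ind => // [|*].
    exact: finite_measurable0.
  exact: finite_measurableU.
- split; first by move=> n m nm; exact/subsetPset/subset_bigsetU.
  rewrite bigcup_bigsetU_bigcup => x Dx.
  have [xN|xN] := boolP (x \in N); first by rewrite /g xN.
  have s0 n : s n x = 0.
    by apply/eqP/negPn/negP => sx; apply: Dx; exists n.
  have := sg x xN; rewrite (_ : (fun n => s n x) = cst 0) => [g0|].
    by apply/esym/(cvg_unique _ (cvg_cst _) g0); exact: norm_hausdorff.
  by apply/funext.
Qed.

End versions.

(** * Integrals of functions with sigma-finite support *)

Section sigma_finite_support.
Context (R : realType) (d : measure_display) (T : measurableType d).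
Variable mu : {measure set T -> \bar R}.
Local Notation Sf := (finite_measurable mu).
Variables (u : T -> R) (D : nat -> set T).
Hypotheses (mu_u : measurable_fun setT u) (SD : forall n, Sf (D n)).
Hypotheses (ndD : nondecreasing_seq D) (uD : forall x, ~ (\bigcup_n D n) x -> u x = 0).

Let mD n : measurable (D n). Proof. by have [] := SD n. Qed.

(** Split B according to the sign of u. *)
Lemma abs_integral_bounded M : (forall B, Sf B -> mu.-integrable B (EFin \o u)) ->
  (forall B, Sf B -> `|\int[mu]_(x in B) u x| <= M) ->
  forall B, Sf B -> \int[mu]_(x in B) `|u x| <= M *+ 2.
Proof.
move=> iu uM B SB; have [mB _] := SB.
have mP : measurable (u @^-1` `[0, +oo[) by rewrite -[X in measurable X]setTI; exact: mu_u.
set P := u @^-1` _ in mP.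
have dis : [disjoint B `&` P & B `\` P].
  by apply/disj_setPS => x [[_ Px] [_]].
have SBP : Sf (B `&` P).
  by apply: (finite_measurable_sub SB); [exact: measurableI|exact: subIsetl].
have SBN : Sf (B `\` P).
  by apply: (finite_measurable_sub SB); [exact: measurableD|exact: subDsetl].
have BE : B = (B `&` P) `|` (B `\` P) by rewrite setUIDK.
rewrite [in leLHS]BE Rintegral_setU//.
- rewrite mulr2n lerD//.
    have -> : \int[mu]_(x in B `&` P) `|u x| = \int[mu]_(x in B `&` P) u x.
      apply: eq_Rintegral => x; rewrite inE => -[_].
      by rewrite /P/= in_itv/= andbT => /ger0_norm.
    exact: le_trans (ler_norm _) (uM _ SBP).
  have -> : \int[mu]_(x in B `\` P) `|u x| = \int[mu]_(x in B `\` P) (-1 * u x).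
    apply: eq_Rintegral => x; rewrite inE => -[_].
    by rewrite /P/= in_itv/= andbT mulN1r => /negP; rewrite -ltNge => /ltr0_norm.
  rewrite RintegralZl; [|by have [] := SBN|exact: iu].
  by rewrite mulN1r; apply: le_trans (ler_norm _) _; rewrite normrN; exact: uM.
- by have [] := SBP.
- by have [] := SBN.
- by rewrite -BE; exact: integrable_norm (iu _ SB).
Qed.

(** The D n exhaust the support of u, so monotone convergence gives a bound on
    the integral of |u| from the bounds on the D n. *)
Lemma integrable_bounded_integrals M :
  (forall B, Sf B -> mu.-integrable B (EFin \o u)) ->
  (forall B, Sf B -> `|\int[mu]_(x in B) u x| <= M) ->
  mu.-integrable setT (EFin \o u).
Proof.
move=> iu uM; apply/integrableP; split; first exact/measurable_EFinP.
have -> : (\int[mu]_x `|(EFin \o u) x| =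
    \int[mu]_(x in \bigcup_n D n) `|(EFin \o u) x|)%E.
  rewrite [RHS]integral_mkcond; apply: eq_integral => x _.
  rewrite /patch; case: ifPn => // /negP xD.
  by rewrite /= uD ?normr0// => /mem_set.
apply: (@le_lt_trans _ _ (M *+ 2)%:E); last exact: ltry.
have mabs : measurable_fun setT (fun x => `|(EFin \o u) x|%E).
  by apply: measurableT_comp => //; exact/measurable_EFinP.
have /cvg_lim <- // := @ge0_nondecreasing_set_cvg_integral _ _ _ D
  (fun x => `|(EFin \o u) x|%E) mu ndD mD (fun n => measurable_funTS mabs)
  (fun n x _ => abse_ge0 _).
apply: lime_le.
  apply/cvg_ex; eexists; apply: ge0_nondecreasing_set_cvg_integral => // n.
  exact: measurable_funTS.
apply: nearW => n.
have := abs_integral_bounded iu uM (SD n).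
rewrite /Rintegral -lee_fin fineK//.
by apply: integrable_fin_num => //; exact: integrable_norm (iu _ (SD n)).
Qed.

(** Dominated convergence along the exhaustion D n of the support of u. *)
Lemma le_norm_integral_exhaust c A : mu.-integrable setT (EFin \o u) -> measurable A ->
  (forall n, `|\int[mu]_(x in A `&` D n) u x| <= c) ->
  `|\int[mu]_(x in A) u x| <= c.
Proof.
move=> iu mA uc.
have iA : mu.-integrable A (EFin \o u) by exact: integrableS iu.
have iAD n : mu.-integrable (A `&` D n) (EFin \o u).
  by apply: integrableS iA => //; exact: measurableI.
have [| | | | |_ _ cvgI] := @dominated_convergence _ _ _ mu A mA
  (fun n => (EFin \o u) \_ (D n)) (EFin \o u) (fun x => `|(EFin \o u) x|%E).
- move=> n; apply/(measurable_restrict _ _ _) => //.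
  by apply: measurable_funTS; exact/measurable_EFinP.
- by apply: measurable_funTS; exact/measurable_EFinP.
- apply: aeW => x Ax; have [[n _ Dx]|Dx] := pselect ((\bigcup_n D n) x).
    apply: cvg_near_cst; exists n => // m /= nm; apply/eqP.
    by rewrite /patch mem_set//; exact: (subsetPset _ _ (ndD nm)).
  rewrite (_ : (fun _ => _) = cst ((EFin \o u) x)); first exact: cvg_cst.
  by apply/funext => n; rewrite /patch; case: ifPn => //; rewrite /= uD.
- exact: integrable_abse.
- apply: aeW => x n Ax; rewrite /patch; case: ifPn => // _.
  by rewrite abse0 abse_ge0.
have {}cvgI : \int[mu]_(x in A `&` D n) u x @[n --> \oo] --> \int[mu]_(x in A) u x.
  rewrite (_ : (fun n => _) = fine \o
      (fun n => \int[mu]_(x in A) ((EFin \o u) \_ (D n)) x)%E); last first.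
    by apply/funext => n; rewrite /Rintegral integral_mkcondr.
  by apply: fine_cvg; rewrite /Rintegral fineK//; exact: integrable_fin_num.
rewrite -(cvg_lim _ (cvg_norm cvgI))//; apply: limr_le; last exact: nearW.
by apply/cvg_ex; eexists; exact: cvg_norm cvgI.
Qed.

End sigma_finite_support.

Lemma Rintegral_ae_version (R : realType) (d : measure_display) (T : measurableType d)
    (mu : {measure set T -> \bar R}) (h u : T -> R) (B : set T) :
  measurable B -> mu.-integrable setT (EFin \o h) -> measurable_fun setT u ->
  {ae mu, forall x, B x -> h x = u x} ->
  mu.-integrable B (EFin \o u) /\ \int[mu]_(x in B) h x = \int[mu]_(x in B) u x.
Proof.
move=> mB ih mu_u hu.
have ihB : mu.-integrable B (EFin \o h) by exact: integrableS ih.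
have mhB := measurable_int _ ihB.
have muB : measurable_fun B (EFin \o u) by apply/measurable_EFinP; exact: measurable_funTS.
have hue : ae_eq mu B (EFin \o h) (EFin \o u).
  by apply: filterS hu => x hux Bx /=; rewrite hux.
split.
  apply/integrableP; split=> //.
  have <- : (\int[mu]_(x in B) `|(EFin \o h) x| = \int[mu]_(x in B) `|(EFin \o u) x|)%E.
    apply: ae_eq_integral => //; [exact: measurableT_comp|exact: measurableT_comp|].
    by apply: filterS hue => x hux Bx; rewrite hux.
  by have /integrableP[] := ihB.
by congr fine; exact: ae_eq_integral.
Qed.

(** * Functionals of the Pettis set function *)

(** Over the real scalars both sides are 0. *)
Lemma im_of_re_im_integral (R : realType) (k : scalar_kind) (d : measure_display)
    (T : measurableType d) (mu : {measure set T -> \bar R}) (B : set T)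
    (h : T -> base_field R k) (a : R) :
  im (of_re_im k a (\int[mu]_(x in B) im (h x))) = \int[mu]_(x in B) im (h x).
Proof. by case: k h => h //=; rewrite /Rintegral integral0. Qed.

Section pettis.
Context (R : realType) (k : scalar_kind) (d : measure_display) (T : measurableType d).
Variable mu : {measure set T -> \bar R}.
Local Notation K := (base_field R k).
Local Notation Sf := (finite_measurable mu).

Section functional_of_set_function.
Variables (X : normedModType K) (F : T -> X).
Hypothesis locF : locally_Pettis_integrable mu F.
Local Notation nu := (Pettis_set_function mu F).

Lemma Pettis_set_functionP (phi : {linear X -> K^o}) (g : T -> K) B :
  continuous phi -> measurable_fun setT (fun x => re (g x)) ->
  measurable_fun setT (fun x => im (g x)) ->
  {ae mu, forall x, phi (F x) = g x} -> Sf B ->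
  [/\ mu.-integrable B (fun x => (re (g x))%:E),
      mu.-integrable B (fun x => (im (g x))%:E),
      re (phi (nu B)) = \int[mu]_(x in B) re (g x) &
      im (phi (nu B)) = \int[mu]_(x in B) im (g x)].
Proof.
move=> cphi mre mim phig SB; have [mB _] := SB.
have [_ _ /(_ B mB)/getPex] := locF.2 B SB.
move=> /(_ phi cphi)[h [ire iim hphi] nuE].
have hg : {ae mu, forall x, B x -> h x = g x}.
  move: phig hphi; apply: filterS2 => x <- <- Bx.
  by rewrite /Defs.cut /indic mem_set// scale1r.
have [? reE] := Rintegral_ae_version mB ire mre
  (filterS (fun x H Bx => congr1 (@re R k) (H Bx)) hg).
have [? imE] := Rintegral_ae_version mB iim mim
  (filterS (fun x H Bx => congr1 (@im R k) (H Bx)) hg).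
split=> //.
  by rewrite /Pettis_set_function /Pettis_integral nuE re_of_re_im.
by rewrite /Pettis_set_function /Pettis_integral nuE im_of_re_im_integral.
Qed.

(** The dual separates points, and for each functional this is the additivity of
    a scalar integral. *)
Lemma Pettis_set_functionU A B : Sf A -> Sf B -> A `&` B = set0 ->
  nu (A `|` B) = nu A + nu B.
Proof.
move=> SA SB AB; apply: eq_of_functionals => phi cphi.
have [g [_ [mre mim phig _ _]]] := strongly_measurable_version (locF.1 phi cphi).
have [reA imA reAE imAE] := Pettis_set_functionP cphi mre mim phig SA.
have [reB imB reBE imBE] := Pettis_set_functionP cphi mre mim phig SB.
have [reAB imAB reABE imABE] :=
  Pettis_set_functionP cphi mre mim phig (finite_measurableU SA SB).
have dis : [disjoint A & B] by apply/disj_setPS; rewrite AB.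
rewrite linearD/= -[LHS]of_re_imK -[RHS]of_re_imK re_additive im_additive.
rewrite reABE imABE reAE imAE reBE imBE.
by congr of_re_im; (apply: Rintegral_setU => //; [have [] := SA|have [] := SB]).
Qed.

End functional_of_set_function.

(** Here f stands for the real or the imaginary part of a functional phi, and u
    for the same part of a version of phi o F. *)
Section component.
Variables (X : normedModType K) (nu : set T -> X) (f : X -> R) (c : R).
Hypotheses (fD : {morph f : y z / y + z}) (fc : forall y, `|f y| <= c * rnorm y).
Hypothesis c0 : 0 <= c.
Variables (u : T -> R) (D : nat -> set T).
Hypotheses (mu_u : measurable_fun setT u) (SD : forall n, Sf (D n)).
Hypotheses (ndD : nondecreasing_seq D) (uD : forall x, ~ (\bigcup_n D n) x -> u x = 0).
Hypothesis iu : forall B, Sf B -> mu.-integrable B (EFin \o u).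
Hypothesis fnu : forall B, Sf B -> f (nu B) = \int[mu]_(x in B) u x.

Lemma component_integrable C : (forall B, Sf B -> rnorm (nu B) <= C) ->
  mu.-integrable setT (EFin \o u).
Proof.
move=> nuC; apply: (integrable_bounded_integrals mu_u SD ndD uD (M := c * C)) => //.
by move=> B SB; rewrite -fnu// (le_trans (fc _))// ler_wpM2l// nuC.
Qed.

(** The difference of the two sides is at most c |x - nu(A `&` B n)| plus the
    integral of u over A minus B n; the latter is a limit of values of f o nu on
    sets of finite measure disjoint from B n, hence at most c / (n + 1). *)
Lemma component_integral (A : set T) (B : nat -> set T) (x : X) :
  mu.-integrable setT (EFin \o u) -> measurable A -> (forall n, Sf (B n)) ->
  (forall n B', Sf B' -> B' `&` B n = set0 -> rnorm (nu B') <= n.+1%:R^-1) ->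
  nu (A `&` B n) @[n --> \oo] --> x -> f x = \int[mu]_(y in A) u y.
Proof.
move=> iuT mA SB nuB /cvg_rnormP xlim; apply/eqP; rewrite -subr_eq0 -normr_le0.
apply/ler_addgt0Pl => e e0; rewrite addr0.
pose dl := e / (c *+ 2 + 1).
have c2 : 0 < c *+ 2 + 1 by rewrite ltr_wpDl// mulrn_wge0.
have dl0 : 0 < dl by rewrite divr_gt0.
have [N xN] := xlim _ dl0.
have [n Nn ndl] : exists2 n, (N <= n)%N & n.+1%:R^-1 <= dl.
  exists (maxn N (Num.truncn dl^-1)); first exact: leq_maxl.
  rewrite invf_ple ?posrE// ltW// (lt_le_trans (truncnS_gt _))// ler_nat ltnS.
  exact: leq_maxr.
have mB : measurable (B n) by have [] := SB n.
have SAB : Sf (A `&` B n).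
  by apply: (finite_measurable_sub (SB n)); [exact: measurableI|exact: subIsetr].
have split_A : \int[mu]_(y in A) u y =
    f (nu (A `&` B n)) + \int[mu]_(y in A `\` B n) u y.
  rewrite fnu// -{1}(setUIDK A (B n)) Rintegral_setU//.
  - exact: measurableI.
  - exact: measurableD.
  - rewrite setUIDK; exact: integrableS iuT.
  - by apply/disj_setPS => y [[_ By] [_]].
have rest : `|\int[mu]_(y in A `\` B n) u y| <= c * dl.
  apply: (le_norm_integral_exhaust mu_u SD ndD uD) => //; first exact: measurableD.
  move=> m; have [mDm _] := SD m.
  have SAD : Sf ((A `\` B n) `&` D m).
    apply: (finite_measurable_sub (SD m)); last exact: subIsetr.
    by apply: measurableI => //; exact: measurableD.
  rewrite -fnu// (le_trans (fc _))// ler_wpM2l// (le_trans _ ndl)// nuB//.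
  by rewrite -subset0 => y [[[_ +] _]].
have f0 : f 0 = 0 by have := fD 0 0; rewrite addr0; lra.
have fB y z : f (y - z) = f y - f z.
  by have := fD (y - z) z; rewrite subrK; lra.
rewrite split_A opprD addrA -fB (le_trans (ler_normB _ _))//.
have := fc (x - nu (A `&` B n)).
have := ler_wpM2l c0 (xN n Nn).
have : c * dl + c * dl <= e.
  by rewrite /dl -mulr2n -mulrnAl mulrCA ger_pMr// ler_pdivrMr// mul1r lerDl.
lra.
Qed.

End component.
End pettis.

(** * Pettis integrability *)

Theorem corollary4p5 (R : realType) (k : scalar_kind)
    (d : measure_display) (Omega : measurableType d)
    (mu : {measure set Omega -> \bar R})
    (X : completeNormedModType (base_field R k)) (F : Omega -> X) :
  locally_determined mu ->
  locally_Pettis_integrable mu F ->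
  ~ contains_copy X (c0 R k) ->
  bounded_set (Pettis_set_function mu F @` finite_measurable mu) ->
  Pettis_integrable mu F.
Proof.
move=> _ locF noc0 /pinfty_ex_gt0[M M0 nuM].
pose nu := Pettis_set_function mu F; pose Sf := finite_measurable mu.
have nuC B : Sf B -> rnorm (nu B) <= re M.
  move=> SB; rewrite -(of_real_le k) rnormK (ge0_of_re (ltW M0)).
  exact: (nuM (nu B) (ex_intro2 _ _ B SB erefl)).
have nuU A B : Sf A -> Sf B -> A `&` B = set0 -> nu (A `|` B) = nu A + nu B.
  exact: Pettis_set_functionU.
have exh n : exists B0, Sf B0 /\
    forall B, Sf B -> B `&` B0 = set0 -> rnorm (nu B) <= n.+1%:R^-1.
  have n0 : 0 < n.+1%:R^-1 :> R by rewrite invr_gt0.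
  by have [B0] := additive_exhaustion (finite_measurable0 mu)
    (@finite_measurableU _ _ _ mu) nuU nuC noc0 n0; exists B0.
have [B0 B0P] := choice exh.
pose B n := \big[setU/set0]_(i < n.+1) B0 i.
have SB n : Sf (B n).
  apply: big_ind => [|? ?|i _]; [exact: finite_measurable0|exact: finite_measurableU|].
  exact: (B0P i).1.
have nuB n B' : Sf B' -> B' `&` B n = set0 -> rnorm (nu B') <= n.+1%:R^-1.
  move=> SB' dis; apply: (B0P n).2 => //; rewrite -subset0 -dis; apply: setIS.
  by rewrite /B big_ord_recr; exact: subsetUr.
have BS n m : (n <= m)%N -> B n `<=` B m by move=> nm; exact: subset_bigsetU.
(* For n <= m, nu(A `&` B m) - nu(A `&` B n) is the value of nu on a set
   disjoint from B n. *)
have lim_nu A : measurable A -> cvg (nu (A `&` B n) @[n --> \oo]).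
  move=> mA; apply: cauchy_rnorm_cvg => e e0.
  exists (Num.truncn e^-1) => n m en nm.
  have SAB i : Sf (A `&` B i).
    apply: (finite_measurable_sub (SB i)); last exact: subIsetr.
    by apply: measurableI => //; have [] := SB i.
  have SD : Sf ((A `&` B m) `\` B n).
    apply: (finite_measurable_sub (SAB m)); last exact: subDsetl.
    by apply: measurableD; [have [] := SAB m|have [] := SB n].
  have -> : A `&` B m = (A `&` B n) `|` ((A `&` B m) `\` B n).
    rewrite -{1}(setUIDK (A `&` B m) (B n)) -setIA (setIidr (BS _ _ nm)) //.
  rewrite nuU//; last by rewrite -subset0 => x [[_ Bx] [_]].
  rewrite addrC addKr (le_trans (nuB n _ SD _))//.
    by rewrite -subset0 => x [[_ +] ?].
  rewrite invf_ple ?posrE// ltW// (lt_le_trans (truncnS_gt _))// ler_nat ltnS.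
  exact: en.
have key (phi : {linear X -> (base_field R k)^o}) : continuous phi ->
    exists2 g, integrable_version mu (fun w => phi (F w)) g &
    forall A x, measurable A -> nu (A `&` B n) @[n --> \oo] --> x ->
      phi x = of_re_im k (\int[mu]_(w in A) re (g w)) (\int[mu]_(w in A) im (g w)).
  move=> cphi; have [c c0 phic] := continuous_rnorm_bound cphi.
  have [g [D [mre mim phig SD [ndD gD]]]] := strongly_measurable_version (locF.1 phi cphi).
  have gP A SA := @Pettis_set_functionP _ k _ _ mu X F locF phi g A cphi mre mim phig SA.
  have reD : {morph (fun y => re (phi y)) : y z / y + z}.
    by move=> y z; rewrite linearD/= re_additive.
  have imD : {morph (fun y => im (phi y)) : y z / y + z}.
    by move=> y z; rewrite linearD/= im_additive.
  have rec y : `|re (phi y)| <= c * rnorm y := le_trans (ler_norm_re _) (phic y).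
  have imc y : `|im (phi y)| <= c * rnorm y := le_trans (ler_norm_im _) (phic y).
  have reg0 w : ~ (\bigcup_n D n) w -> re (g w) = 0 by move/gD ->; exact: re0.
  have img0 w : ~ (\bigcup_n D n) w -> im (g w) = 0 by move/gD ->; exact: im0.
  have ire : mu.-integrable setT (fun w => (re (g w))%:E).
    apply: (component_integrable rec c0 mre SD ndD reg0 _ _ nuC) => A SA.
      by have [] := gP A SA.
    by have [] := gP A SA.
  have iim : mu.-integrable setT (fun w => (im (g w))%:E).
    apply: (component_integrable imc c0 mim SD ndD img0 _ _ nuC) => A SA.
      by have [] := gP A SA.
    by have [] := gP A SA.
  exists g; first by split.
  move=> A x mA xlim; rewrite -[LHS]of_re_imK; congr of_re_im.
    apply: (component_integral reD rec c0 mre SD ndD reg0 _ ire mA SB nuB xlim) => A' SA'.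
    by have [] := gP A' SA'.
  apply: (component_integral imD imc c0 mim SD ndD img0 _ iim mA SB nuB xlim) => A' SA'.
  by have [] := gP A' SA'.
split.
- exact: locF.1.
- by move=> phi /key[g gv _]; exists g.
- move=> A mA; exists (lim (nu (A `&` B n) @[n --> \oo])) => phi /key[g gv gP].
  by exists g => //; apply: gP => //; exact: lim_nu.
Qed.
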